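(* Let $0<c<1$ and let $a,b$ be real parameters. Let $J_n(x)=J_n(x;a,b,c)$ be the monic big $-1$ Jacobi polynomials and let $A_n$, $B_n$ be their recurrence coefficients given in the context. Define the kernel partners with kernel parameter $1$ by the Christoffel transformation $$K_n(x)=\frac{1}{x-1}\left[J_{n+1}(x)-\frac{J_{n+1}(1)}{J_n(1)}J_n(x)\right],\qquad n\ge0.$$ Then $J_{n+1}(1)/J_n(1)=A_n$, and the inverse (Geronimus) transformation is $$J_n(x)=K_n(x)-B_nK_{n-1}(x).$$ Moreover the polynomials $K_n$ are, up to rescaling of the variable, the Chihara polynomials: with $$\alpha=\frac b2-\frac12,\qquad \beta=\frac a2+\frac12,\qquad \gamma=-\frac{c}{\sqrt{1-c^2}},$$ one has for every $n\ge0$ $$(1-c^2)^{-n/2}K_n\!\left(x\sqrt{1-c^2}\right)=C_n(x;\alpha,\beta,\gamma).$$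
   Context: The big $-1$ Jacobi polynomials are defined by $J_{-1}(x)=0$, $J_0(x)=1$ and $$xJ_n(x)=J_{n+1}(x)+(1-A_n-B_n)J_n(x)+A_{n-1}B_nJ_{n-1}(x),$$ where $$A_n=\begin{cases}\dfrac{(1+c)(a+n+1)}{2n+a+b+2}& n\text{ even},\\[2mm] \dfrac{(1-c)(n+a+b+1)}{2n+a+b+2}& n\text{ odd},\end{cases}\qquad B_n=\begin{cases}\dfrac{(1-c)n}{2n+a+b}& n\text{ even},\\[2mm] \dfrac{(1+c)(n+b)}{2n+a+b}& n\text{ odd},\end{cases}$$ with $B_0=0$; also $K_{-1}=0$. The parameters $a,b$ are assumed to be such that all expressions are defined, i.e. $2n+a+b+2\neq0$ and $A_n\neq0$ for all $n\ge0$. The Chihara polynomials $C_n(x;\alpha,\beta,\gamma)$ are the monic polynomials $$C_{2n}(x)=(-1)^n\frac{(\alpha+1)_n}{(n+\alpha+\beta+1)_n}\,{}_2F_1\!\left[{-n,\;n+\alpha+\beta+1\atop \alpha+1};x^2-\gamma^2\right],$$ $$C_{2n+1}(x)=(-1)^n\frac{(\alpha+2)_n}{(n+\alpha+\beta+2)_n}(x-\gamma)\,{}_2F_1\!\left[{-n,\;n+\alpha+\beta+2\atop \alpha+2};x^2-\gamma^2\right],$$ where $(a)_n=a(a+1)\cdots(a+n-1)$, $(a)_0=1$, ${}_2F_1$ is the Gauss hypergeometric series, and products of Pochhammer prefactors with ${}_2F_1$ are understood as polynomials (expanded termwise). *)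

(* Defs.v *)
From mathcomp Require Import all_boot all_order all_algebra.
From mathcomp Require Import reals.

Set Implicit Arguments.
Unset Strict Implicit.
Unset Printing Implicit Defensive.

Import Order.TTheory GRing.Theory Num.Theory.
Local Open Scope ring_scope.

(* [prevp P n] is P_(n-1), with the convention P_(-1) = 0. *)
Definition prevp (R : nzRingType) (P : nat -> {poly R}) (n : nat) : {poly R} :=
  if n is m.+1 then P m else 0.

Definition jacobiA (R : fieldType) (a b c : R) (n : nat) : R :=
  if odd n then (1 - c) * (n%:R + a + b + 1) / (2 * n%:R + a + b + 2)
  else (1 + c) * (a + n%:R + 1) / (2 * n%:R + a + b + 2).

(* At n = 0 the numerator vanishes, so B_0 = 0 even when a + b = 0. *)
Definition jacobiB (R : fieldType) (a b c : R) (n : nat) : R :=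
  if odd n then (1 + c) * (n%:R + b) / (2 * n%:R + a + b)
  else (1 - c) * n%:R / (2 * n%:R + a + b).

(* Monic big -1 Jacobi polynomials; the recurrence is solved for the term of
   highest degree, and the J_(-1) term is dropped when m = 0. *)
Fixpoint bigm1Jacobi (R : fieldType) (a b c : R) (n : nat) : {poly R} :=
  if n is m.+1 then
    ('X - (1 - jacobiA a b c m - jacobiB a b c m)%:P) * bigm1Jacobi a b c m
    - (if m is k.+1 then
         (jacobiA a b c k * jacobiB a b c m) *: bigm1Jacobi a b c k
       else 0)
  else 1.

(* Christoffel transform at the point 1.  [%/] is Euclidean division of
   polynomials; it is exact as soon as J_n(1) != 0. *)
Definition kernelPartner (R : fieldType) (a b c : R) (n : nat) : {poly R} :=
  let J := bigm1Jacobi a b c in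
  (J n.+1 - ((J n.+1).[1] / (J n).[1]) *: J n) %/ ('X - 1%:P).

Definition poch (R : nzRingType) (x : R) (n : nat) : R :=
  \prod_(i < n) (x + i%:R).

(* The terminating Gauss series 2F1(-n, e; d; y). *)
Definition hyp2F1 (R : fieldType) (n : nat) (e d : R) (y : {poly R}) :
    {poly R} :=
  \sum_(k < n.+1)
    (poch (- n%:R) k * poch e k / (poch d k * k`!%:R)) *: y ^+ k.

(* (d)_n 2F1(-n, e; d; y) expanded termwise with (d)_n / (d)_k = (d + k)_(n-k),
   so that it makes sense also when (d)_n = 0; see [poch_hyp2F1E]. *)
Definition poch_hyp2F1 (R : fieldType) (n : nat) (e d : R) (y : {poly R}) :
    {poly R} :=
  \sum_(k < n.+1)
    (poch (- n%:R) k * poch e k * poch (d + k%:R) (n - k) / k`!%:R) *: y ^+ k.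

Lemma poch_split (R : nzRingType) (x : R) (n k : nat) :
  (k <= n)%N -> poch x n = poch x k * poch (x + k%:R) (n - k).
Proof.
move=> le_kn; rewrite /poch -!(big_mkord xpredT (fun i => _ + i%:R)).
rewrite (@big_cat_nat _ _ _ k) //=; congr (_ * _).
rewrite -{1}[k]add0n big_addn; apply: eq_bigr => i _.
by rewrite natrD [i%:R + _]addrC addrA.
Qed.

Lemma poch_hyp2F1E (R : fieldType) (n : nat) (e d : R) (y : {poly R}) :
  poch d n != 0 -> poch_hyp2F1 n e d y = poch d n *: hyp2F1 n e d y.
Proof.
move=> dn0; rewrite /hyp2F1 scaler_sumr; apply: eq_bigr => k _.
have le_kn : (k <= n)%N by rewrite -ltnS.
move: dn0; rewrite scalerA (poch_split d le_kn) mulf_eq0 negb_or => /andP[dk0 _].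
rewrite invfM; apply/esym.
by rewrite [X in poch d k * _ * X]mulrCA mulrACA mulfV // mul1r mulrCA mulrA.
Qed.

Definition chihara (R : fieldType) (alpha beta gamma : R) (m : nat) :
    {poly R} :=
  let n := m./2 in
  let y := 'X^2 - (gamma ^+ 2)%:P in
  if odd m then
    ((-1) ^+ n / poch (n%:R + alpha + beta + 2) n) *:
      (('X - gamma%:P) *
       poch_hyp2F1 n (n%:R + alpha + beta + 2) (alpha + 2) y)
  else
    ((-1) ^+ n / poch (n%:R + alpha + beta + 1) n) *:
      poch_hyp2F1 n (n%:R + alpha + beta + 1) (alpha + 1) y.

(* Main.v *)
Require Import Defs.
From mathcomp Require Import all_boot all_order all_algebra.
From mathcomp Require Import reals.
From mathcomp Require Import ring zify.

(* Since J_(n+1)(1) = A_n J_n(1), the recurrence of J factors as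
   (x - 1) K_n = J_(n+1) - A_n J_n  and  J_n = K_n - B_n K_(n-1),
   and eliminating J gives
   K_(n+1) = (x - (1 - A_n - B_(n+1))) K_n - A_n B_n K_(n-1),
   where 1 - A_n - B_(n+1) = (-1)^(n+1) c.  Up to rescaling this is the
   recurrence of the Chihara polynomials, whose even and odd steps are two
   contiguous relations of 2F1, checked coefficient by coefficient. *)

Set Implicit Arguments.
Unset Strict Implicit.
Unset Printing Implicit Defensive.

Import Order.TTheory GRing.Theory Num.Theory.
Local Open Scope ring_scope.

(** * Pochhammer symbols *)

Lemma poch0 (R : nzRingType) (x : R) : poch x 0 = 1.
Proof. by rewrite /poch big_ord0. Qed.

Lemma pochSr (R : nzRingType) (x : R) n : poch x n.+1 = poch x n * (x + n%:R).
Proof. by rewrite /poch big_ord_recr. Qed.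

Lemma pochSl (R : nzRingType) (x : R) n : poch x n.+1 = x * poch (x + 1) n.
Proof. by rewrite (@poch_split _ x n.+1 1) // subSS subn0 pochSr poch0 mul1r addr0. Qed.

Lemma poch_neq0 (R : idomainType) (x : R) n :
  (forall i, x + i%:R != 0) -> poch x n != 0.
Proof. by move=> x0; apply/prodf_neq0 => i _. Qed.

Lemma pochN (R : comNzRingType) (n k : nat) :
  poch (- n%:R : R) k = (-1) ^+ k * ('C(n, k) * k`!)%N%:R.
Proof.
rewrite bin_ffact; elim: k => [|k IHk].
  by rewrite poch0 expr0 ffactn0 mul1r.
rewrite pochSr IHk ffactnSr natrM.
(* For [k > n] the subtraction [n - k] truncates, but both sides vanish with the falling
   factorial. *)
have [le_kn|lt_nk] := leqP k n; last by rewrite ffact_small // !(mul0r, mulr0).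
rewrite natrB // exprS.
by ring.
Qed.

(** * Monic terminating hypergeometric polynomials and two contiguous relations *)

Section MonicHypergeometric.
Variable R : numFieldType.
Implicit Types d e : R.

(* (-1)^n (d)_n / (e)_n 2F1(-n, e; d; X) with the common factors of the
   Pochhammer symbols cancelled, so that d may be arbitrary. *)
Definition mhyp d e n : {poly R} :=
  \poly_(k < n.+1) ((-1) ^+ (n - k) * 'C(n, k)%:R *
                    poch (d + k%:R) (n - k) / poch (e + k%:R) (n - k)).

(** Beyond degree [n] the binomial vanishes, so one formula serves every index. *)
Lemma coef_mhyp d e n k :
  (mhyp d e n)`_k = (-1) ^+ (n - k) * 'C(n, k)%:R *
                    poch (d + k%:R) (n - k) / poch (e + k%:R) (n - k).
Proof.
rewrite coef_poly ltnS; case: leqP => // lt_nk.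
by rewrite bin_small // mulr0 !mul0r.
Qed.

(** Termwise, (-n)_k / k! is (-1)^k times a binomial, and (e)_k / (e)_n is 1 / (e + k)_(n-k). *)
Lemma poch_hyp2F1_mhyp n d e y : (forall i, e + i%:R != 0) ->
  ((-1) ^+ n / poch e n) *: poch_hyp2F1 n e d y = mhyp d e n \Po y.
Proof.
move=> e0; rewrite /poch_hyp2F1 scaler_sumr /mhyp poly_def raddf_sum /=.
apply: eq_bigr => k _; have le_kn : (k <= n)%N by rewrite -ltnS.
rewrite scalerA linearZ /= comp_Xn_poly; congr (_ *: _).
have ek0 := poch_neq0 k e0.
have enk0 : poch (e + k%:R) (n - k) != 0.
  by apply: poch_neq0 => i; rewrite -addrA -natrD.
have f0 : k`!%:R != 0 :> R by rewrite pnatr_eq0 -lt0n fact_gt0.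
rewrite pochN (poch_split e le_kn) -[in (-1) ^+ n](subnK le_kn) exprD natrM.
have s1 : (-1) ^+ k * (-1) ^+ k = 1 :> R by rewrite -exprMn mulrNN mulr1 expr1n.
transitivity ((-1) ^+ k * (-1) ^+ k * ((-1) ^+ (n - k) * 'C(n, k)%:R *
   poch (d + k%:R) (n - k) / poch (e + k%:R) (n - k))); last by rewrite s1 mul1r.
by field; rewrite ek0 enk0 f0.
Qed.

(** Gives the odd step of the Chihara recurrence. For [k <= n] and [j = n - k], the coefficients of
    ['X^k] share the factor 'C(n+1, k) (d+k+1)_j / (e+k+1)_j up to sign; dividing it out leaves a
    rational identity in [d], [e], [k], [j]. *)
Lemma mhyp_contig1 d e n : (forall i, e + i%:R != 0) ->
  mhyp (d + 1) (e + 1) n.+1 = mhyp d e n.+1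
    - (n.+1%:R * (e - d) / ((e + n%:R) * (e + n%:R + 1))) *: mhyp (d + 1) e n.
Proof.
move=> e0; apply/polyP=> k; rewrite coefB coefZ !coef_mhyp.
have [le_kn|] := leqP k n; last first.
  (* At [k = n + 1] the monic leading terms match; above that every coefficient is zero. *)
  rewrite leq_eqVlt => /predU1P[<-|lt_nk].
    by rewrite subnn !poch0 binn (@bin_small n n.+1) //
      !(mulr0n, mulr0, mul0r, subr0).
  by rewrite (bin_small lt_nk) (bin_small (ltnW lt_nk))
    !(mulr0n, mulr0, mul0r, subr0).
rewrite subSn //.
move: (n - k)%N (subnKC le_kn) => j jE.
have nE : n%:R = k%:R + j%:R :> R by rewrite -natrD jE.
have bE : n.+1%:R * 'C(n, k)%:R = (j.+1)%:R * 'C(n.+1, k)%:R :> R.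
  by rewrite -!natrM -[n in 'C(n, k)]/(n.+1.-1) mul_bin_down subSn // -jE addKn.
rewrite !(addrAC _ 1) !(pochSr (_ + 1)) !(pochSl (_ + k%:R)).
have ek0 i : e + k%:R + i%:R != 0 by rewrite -addrA -natrD.
have en0 : e + k%:R + j%:R != 0 by [].
have en1 : e + k%:R + j%:R + 1 != 0 by rewrite -addrA natr1.
have e_k0 : e + k%:R != 0 by [].
have V0 : poch (e + k%:R + 1) j != 0.
  by apply: poch_neq0 => i; rewrite -!addrA nat1r -natrD.
have -> : poch (e + k%:R) j =
    (e + k%:R) * poch (e + k%:R + 1) j / (e + k%:R + j%:R).
  by rewrite -pochSl pochSr mulfK.
have -> : 'C(n, k)%:R = (j%:R + 1) * 'C(n.+1, k)%:R / n.+1%:R :> R.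
  by rewrite natr1 -bE mulrC mulKf // pnatr_eq0.
have n0 : k%:R + j%:R + 1 != 0 :> R by rewrite -nE natr1 pnatr_eq0.
rewrite -[n.+1%:R]natr1 nE addrA.
move: (poch (d + _ + _) _) (poch (e + _ + _) _) V0 => U V V0.
rewrite exprS; move: ('C(n.+1, k)%:R : R) => w.
by field; rewrite en0 V0 e_k0 n0 en1.
Qed.

(** Gives the even step of the Chihara recurrence, again by comparing coefficients. *)
Lemma mhyp_contig2 d e n : (forall i, e + i%:R != 0) ->
  mhyp d (e + 1) n.+1 = 'X * mhyp (d + 1) (e + 1) n
    - (e * (d + n%:R) / ((e + n%:R) * (e + n%:R + 1))) *: mhyp d e n.
Proof.
move=> e0; apply/polyP=> k; rewrite coefB coefZ coefXM !coef_mhyp.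
have [le_kn|] := leqP k n; last first.
  rewrite leq_eqVlt => /predU1P[<-|lt_nk].
    by rewrite /= !subnn !poch0 !binn (@bin_small n n.+1) //
      !(mulr0n, mulr0, mul0r, subr0).
  rewrite (bin_small lt_nk) (bin_small (ltnW lt_nk)) (@bin_small n k.-1) ?if_same;
    last by case: k lt_nk.
  by rewrite !(mulr0n, mulr0, mul0r, subr0) if_same.
rewrite subSn //; move: (n - k)%N (subnKC le_kn) => j jE.
have nE : n%:R = k%:R + j%:R :> R by rewrite -natrD jE.
have n0 : k%:R + j%:R + 1 != 0 :> R by rewrite -nE natr1 pnatr_eq0.
have bE : 'C(n, k)%:R = (j%:R + 1) * 'C(n.+1, k)%:R / (k%:R + j%:R + 1) :> R.
  apply: (canRL (mulfK n0)); rewrite mulrC -nE !natr1 -!natrM.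
  by rewrite -[n in 'C(n, k)]/(n.+1.-1) mul_bin_down subSn // -jE addKn.
set X := (if k == 0 then _ else _).
(* Multiplication by ['X] shifts the index to [k - 1], and 'C(n, k-1) = k 'C(n+1, k) / (n+1). The
   factor [k] also covers the zero coefficient at [k = 0]. *)
have {X}-> : X = (-1) ^+ j.+1 * (k%:R * 'C(n.+1, k)%:R / (k%:R + j%:R + 1)) *
    poch (d + k%:R) j.+1 / poch (e + k%:R) j.+1.
  rewrite {}/X -nE natr1; case: k le_kn jE {nE n0 bE} => [|k] lt_kn jE.
    by rewrite eqxx !(mul0r, mulr0).
  rewrite /= -natrM -mul_bin_diag natrM [n.+1%:R * _]mulrC.
  rewrite mulfK ?pnatr_eq0 // -!addrA !nat1r.
  by have -> : (n - k = j.+1)%N by lia.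
have ek0 i : e + k%:R + i%:R != 0 by rewrite -addrA -natrD.
have en0 : e + k%:R + j%:R != 0 by [].
have en1 : e + k%:R + j%:R + 1 != 0 by rewrite -addrA natr1.
have e_k0 : e + k%:R != 0 by [].
have V0 : poch (e + k%:R + 1) j != 0.
  by apply: poch_neq0 => i; rewrite -!addrA nat1r -natrD.
have -> : poch (e + k%:R) j =
    (e + k%:R) * poch (e + k%:R + 1) j / (e + k%:R + j%:R).
  by rewrite -pochSl pochSr mulfK.
rewrite bE nE addrA [e + 1 + _]addrAC (pochSr (d + _)) (pochSr (e + _ + _)).
rewrite (pochSl (e + _)) !addrA.
move: (poch (d + _) _) (poch (e + _ + _) _) V0 => U V V0.
rewrite exprS; move: ('C(n.+1, k)%:R : R) => w.
by field; rewrite en0 V0 e_k0 n0 en1.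
Qed.

End MonicHypergeometric.

(** * Three-term recurrence of the Chihara polynomials, split by parity *)

Section Chihara.
Variables (R : numFieldType) (alpha beta gamma : R).
Hypothesis den_neq0 : forall n : nat, alpha + beta + 1 + n%:R != 0.
Local Notation C := (chihara alpha beta gamma).
Local Notation y := ('X^2 - (gamma ^+ 2)%:P).

Let den_shift_neq0 (n i : nat) : n%:R + alpha + beta + 1 + i%:R != 0.
Proof.
rewrite (_ : _ + i%:R = alpha + beta + 1 + (n + i)%:R) //.
by rewrite natrD; ring.
Qed.

Lemma chihara_even n :
  C n.*2 = mhyp (alpha + 1) (n%:R + alpha + beta + 1) n \Po y.
Proof.
by rewrite /chihara odd_double half_double poch_hyp2F1_mhyp.
Qed.

Lemma chihara_odd n :
  C n.*2.+1 = ('X - gamma%:P) *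
    (mhyp (alpha + 1 + 1) (n%:R + alpha + beta + 1 + 1) n \Po y).
Proof.
rewrite /chihara /= odd_double uphalf_double /= scalerAr poch_hyp2F1_mhyp.
  by rewrite -!(addrA _ 1 1).
move=> i; rewrite (_ : _ + i%:R = n%:R + alpha + beta + 1 + i.+1%:R) //.
by rewrite -natr1; ring.
Qed.

(** In the second contiguous relation ['X] becomes [y], which factors as (x + gamma)(x - gamma); the
    factor x - gamma is the one carried by the odd polynomial. *)
Lemma chihara_rec_even n :
  C n.+1.*2 = ('X + gamma%:P) * C n.*2.+1
    - ((n%:R + alpha + beta + 1) * (n%:R + alpha + 1)
      / ((2 * n%:R + alpha + beta + 1) * (2 * n%:R + alpha + beta + 2))) *: C n.*2.
Proof.
rewrite !chihara_even chihara_odd.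
have -> : n.+1%:R + alpha + beta + 1 = n%:R + alpha + beta + 1 + 1.
  by rewrite -natr1; ring.
rewrite mhyp_contig2 // comp_polyB comp_polyZ comp_polyM comp_polyX mulrA.
congr (_ * _ - _ *: _); first by ring.
by congr (_ / (_ * _)); ring.
Qed.

(** This is the first contiguous relation at [y], with [d = alpha + 1] and
    [e = n + alpha + beta + 2], multiplied by x - gamma. *)
Lemma chihara_rec_odd n :
  C n.+1.*2.+1 = ('X - gamma%:P) * C n.+1.*2
    - ((n%:R + 1) * (n%:R + beta + 1)
      / ((2 * n%:R + alpha + beta + 2) * (2 * n%:R + alpha + beta + 3)))
      *: C n.*2.+1.
Proof.
rewrite chihara_even !chihara_odd.
rewrite mhyp_contig1 // comp_polyB comp_polyZ mulrBr -scalerAr.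
have -> : n.+1%:R + alpha + beta + 1 = n%:R + alpha + beta + 1 + 1.
  by rewrite -natr1; ring.
congr (_ - _ *: _); rewrite -natr1.
by congr (_ / (_ * _)); ring.
Qed.

End Chihara.

(** * Big -1 Jacobi polynomials and their kernel partners *)

Section Jacobi.
Variables (R : fieldType) (a b c : R).
Local Notation A := (jacobiA a b c).
Local Notation B := (jacobiB a b c).
Local Notation J := (bigm1Jacobi a b c).
Local Notation K := (kernelPartner a b c).

(** At [n = 0] the truncated [n.-1] is harmless, because [prevp J 0] is zero. *)
Lemma bigm1JacobiS n : J n.+1 =
  ('X - (1 - A n - B n)%:P) * J n - (A n.-1 * B n) *: prevp J n.
Proof. by case: n => [|n] //; rewrite scaler0. Qed.

Lemma jacobiB0 : B 0 = 0.
Proof. by rewrite /jacobiB /= mulr0 mul0r. Qed.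

(** At x = 1 the recurrence has diagonal factor A_n + B_n, and by induction its [B n] part cancels
    the J_(n-1) term. *)
Lemma horner_bigm1Jacobi n : (J n.+1).[1] = A n * (J n).[1].
Proof.
elim: n => [|n IHn].
  by rewrite bigm1JacobiS jacobiB0 /= !hornerE; ring.
rewrite bigm1JacobiS [prevp _ _]/= [n.+1.-1]/=.
move: (J n.+1) (J n) IHn => P Q PE.
by rewrite !hornerE PE; ring.
Qed.

Hypothesis A_neq0 : forall n, A n != 0.

Lemma horner_bigm1Jacobi_neq0 n : (J n).[1] != 0.
Proof.
elim: n => [|n IHn]; last by rewrite horner_bigm1Jacobi mulf_neq0.
by rewrite /= hornerC oner_eq0.
Qed.

Lemma bigm1Jacobi_ratio n : (J n.+1).[1] / (J n).[1] = A n.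
Proof. by rewrite horner_bigm1Jacobi mulfK ?horner_bigm1Jacobi_neq0. Qed.

(** Replaces the Euclidean division by a test: exhibiting an exact quotient identifies [K n]. *)
Lemma kernelPartner_unique n P :
  ('X - 1%:P) * P = J n.+1 - A n *: J n -> K n = P.
Proof.
by rewrite /kernelPartner bigm1Jacobi_ratio => <-; rewrite mulKp ?polyXsubC_eq0.
Qed.

(** Both claims follow once J_n + B_n K_(n-1) is seen to be an exact quotient. In the induction, (x
    - 1) K_n is replaced by J_(n+1) - A_n J_n, and the recurrence of [J] closes the step. *)
Lemma kernelPartner_mul n :
  ('X - 1%:P) * K n = J n.+1 - A n *: J n /\ K n = J n + B n *: prevp K n.
Proof.
suff E : ('X - 1%:P) * (J n + B n *: prevp K n) = J n.+1 - A n *: J n.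
  by have KE := kernelPartner_unique E; rewrite -[in LHS]KE in E.
elim: n => [|n IHn].
  by rewrite bigm1JacobiS jacobiB0 /= -!mul_polyC; ring.
have KE := kernelPartner_unique IHn.
move: IHn; rewrite -KE (bigm1JacobiS n.+1) ![prevp _ _.+1]/= [n.+1.-1]/=.
move: (J n.+1) (J n) (K n) => P Q S IHn.
by rewrite mulrDr -!scalerAr IHn -!mul_polyC; ring.
Qed.

Lemma bigm1Jacobi_geronimus n : J n = K n - B n *: prevp K n.
Proof. by rewrite [K n](kernelPartner_mul n).2 addrK. Qed.

Lemma kernelPartner0 : K 0 = 1.
Proof. by rewrite (kernelPartner_mul 0).2 /= scaler0 addr0. Qed.

Lemma kernelPartnerS n : K n.+1 =
  ('X - (1 - A n - B n.+1)%:P) * K n - (A n * B n) *: prevp K n.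
Proof.
have E := (kernelPartner_mul n).1.
have -> : K n.+1 = J n.+1 + B n.+1 *: K n by rewrite (kernelPartner_mul n.+1).2.
move/(canRL (subrK _)): (esym E) => ->.
rewrite bigm1Jacobi_geronimus -!mul_polyC; ring.
Qed.

Hypothesis den_neq0 : forall n : nat, 2 * n%:R + a + b + 2 != 0.

(** [A n] and [B n.+1] share the denominator 2n + a + b + 2, and their numerators add up to 1 + c
    ([n] even) or 1 - c ([n] odd) times it. *)
Lemma jacobi_diag n : 1 - A n - B n.+1 = if odd n then c else - c.
Proof.
have := den_neq0 n; rewrite /jacobiA /jacobiB /= -[n.+1%:R]natr1.
have -> : 2 * (n%:R + 1) + a + b = 2 * n%:R + a + b + 2 by ring.
by case: (odd n) => /= d0; field.
Qed.

End Jacobi.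

(** * Rescaling by [s] and identification with the Chihara polynomials *)

Section Rescaling.
Variables (R : realType) (a b c : R).
Hypotheses (c_gt0 : 0 < c) (c_lt1 : c < 1).
Hypothesis den_neq0 : forall n : nat, 2 * n%:R + a + b + 2 != 0.
Hypothesis A_neq0 : forall n : nat, jacobiA a b c n != 0.
Local Notation A := (jacobiA a b c).
Local Notation B := (jacobiB a b c).
Local Notation K := (kernelPartner a b c).
Local Notation s := (Num.sqrt (1 - c ^+ 2)).
Local Notation alpha := (b / 2 - 1 / 2).
Local Notation beta := (a / 2 + 1 / 2).
Local Notation gamma := (- (c / s)).
Local Notation C := (chihara alpha beta gamma).
Local Notation Ks n := (s ^- n *: (K n \Po (s *: 'X))).

Let s_gt0 : 0 < s. Proof. by rewrite sqrtr_gt0 subr_gt0 expr_lt1 ?ltW. Qed.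
Let s_neq0 : s != 0. Proof. exact: lt0r_neq0. Qed.
Let sE : s ^+ 2 = 1 - c ^+ 2.
Proof. by rewrite sqr_sqrtr // subr_ge0 expr_le1 ?ltW. Qed.

(** Twice this quantity is 2n + a + b + 2. *)
Let den_half n : alpha + beta + 1 + n%:R != 0.
Proof.
have := den_neq0 n; apply: contra_neq => E.
transitivity (2 * (alpha + beta + 1 + n%:R)); last by rewrite E mulr0.
by field.
Qed.

Lemma rescaled_kernel_rec n : Ks n.+2 =
  ('X - ((if odd n.+1 then c else - c) / s)%:P) * Ks n.+1
    - (A n.+1 * B n.+1 / s ^+ 2) *: Ks n.
Proof.
rewrite kernelPartnerS // jacobi_diag // [prevp _ _]/=.
rewrite comp_polyB comp_polyM comp_polyB comp_polyX comp_polyC comp_polyZ.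
move: (K n.+1 \Po _) (K n \Po _) => P Q; set e := if _ then _ else _.
(* All negative powers of the scale are written through the single unknown [u], so that [ring] can
   finish. *)
move: s s_neq0 => r r0; set u := r ^- n.+2.
have -> : r ^- n.+1 = u * r by rewrite /u [r ^+ n.+2]exprSr invfM mulfVK.
have -> : r ^- n = u * r ^+ 2 by rewrite /u -addn2 exprD invfM mulfVK ?expf_neq0.
have E1 : e / r * (u * r) = u * e by field.
have E2 : A n.+1 * B n.+1 / r ^+ 2 * (u * r ^+ 2) = u * (A n.+1 * B n.+1) by field.
rewrite [in RHS]mulrBl scalerA E2 -!mul_polyC [(e / r)%:P * _]mulrA -polyCM E1.
by rewrite !polyCM; ring.
Qed.

Lemma rescaled_kernel0 : Ks 0 = C 0.
Proof.
rewrite (chihara_even _ den_half 0) (kernelPartner0 A_neq0) expr0 invr1 scale1r comp_polyC.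
rewrite /mhyp poly_def big_ord1 !poch0 /= linearZ /= comp_polyC.
by rewrite expr0 bin0 invr1 !mulr1 scale1r.
Qed.

Lemma rescaled_kernel1 : Ks 1 = C 1.
Proof.
rewrite (chihara_odd _ den_half 0) kernelPartnerS // jacobi_diag // kernelPartner0 //.
rewrite /mhyp poly_def big_ord1 !poch0 /= scaler0 subr0 mulr1 linearZ /= !comp_polyC.
rewrite expr0 bin0 invr1 !mulr1 scale1r mulr1 expr1 comp_polyB comp_polyX comp_polyC.
rewrite scalerBr scalerA mulVf // scale1r -mul_polyC -polyCM.
by rewrite mulrN mulrC.
Qed.

(** Both sequences obey the same recurrence: whatever the parity, [A n.+1 * B n.+1] contains (1 +
    c)(1 - c), which cancels [s ^+ 2]. *)
Lemma rescaled_kernel_chihara n : Ks n = C n.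
Proof.
(* A three-term recurrence needs two consecutive indices in the induction. *)
suff [] : Ks n = C n /\ Ks n.+1 = C n.+1 by [].
elim: n => [|n [IH0 IH1]]; first by split; rewrite ?rescaled_kernel0 ?rescaled_kernel1.
split=> //; rewrite rescaled_kernel_rec {}IH0 {}IH1.
have cE : 1 - c ^+ 2 != 0 by rewrite -sE expf_neq0.
have := den_neq0 n.+1; have := den_neq0 n.
rewrite sE /jacobiA /jacobiB -![n.+1%:R]natr1; move: (odd_double_half n).
(* Odd [n] comes first: index [n.+2] is then odd, so the odd Chihara step applies. *)
move: (n./2) (odd n) => m [] <- {n}; rewrite ?add1n ?add0n /= odd_double /=.
  have := chihara_rec_odd gamma den_half m; rewrite doubleS => ->.
  rewrite -[m.*2.+1%:R]natr1 -mul2n natrM => d1 d2.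
  congr (('X - _%:P) * _ - _ *: _); first by rewrite mulNr.
  field; rewrite cE.
  (* The remaining denominators are those of [den_neq0] at [n.+1] and [n], in another form. *)
  by apply/and3P; split=> //; [move: d2|move: d1]; apply: contra_neq => <-; ring.
have := chihara_rec_even gamma den_half m; rewrite doubleS => ->.
rewrite -mul2n natrM => d1 d2; congr (_ * _ - _ *: _); first by rewrite polyCN.
field; rewrite cE.
by apply/and3P; split=> //; [move: d2|move: d1]; apply: contra_neq => <-; ring.
Qed.

End Rescaling.

Theorem mainTheorem4 (R : realType) (a b c : R)
  (c_gt0 : 0 < c) (c_lt1 : c < 1)
  (den_neq0 : forall n : nat, 2 * n%:R + a + b + 2 != 0)
  (A_neq0 : forall n : nat, jacobiA a b c n != 0) :
  let J := bigm1Jacobi a b c in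
  let K := kernelPartner a b c in
  let s := Num.sqrt (1 - c ^+ 2) in
  let alpha := b / 2 - 1 / 2 in
  let beta := a / 2 + 1 / 2 in
  let gamma := - (c / s) in
  forall n : nat,
  [/\ ('X - 1%:P) * K n = J n.+1 - ((J n.+1).[1] / (J n).[1]) *: J n,
      (J n.+1).[1] / (J n).[1] = jacobiA a b c n,
      J n = K n - jacobiB a b c n *: prevp K n
    & s ^- n *: (K n \Po (s *: 'X)) = chihara alpha beta gamma n].
Proof.
move=> J K s alpha beta gamma n; rewrite {}/J {}/K bigm1Jacobi_ratio //; split=> //.
- exact: (kernelPartner_mul A_neq0 n).1.
- exact: bigm1Jacobi_geronimus.
- exact: rescaled_kernel_chihara.
Qed.
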